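(* For $n\in\mathbb{N}=\{1,2,\dots\}$ set $a_{n}=2^{-n^{n}n^{3}}$, $A_{n}=[a_{n}/2,a_{n}]$ and $$F=\Big[\bigcup_{n\in\mathbb{N}}A_{2n}\times\{0\}\Big]\cup\Big[\bigcup_{n\in\mathbb{N}}\{0\}\times A_{2n-1}\Big]\subset\mathbb{R}^2.$$ Then \begin{itemize} \item $F$ does not have an approximate $1$-tangent at $0$, \item $1/\Delta[F]=\infty$, \item $\mathcal{U}_{p}^{1}(F)=\infty$ for all $p\in[1,\infty)$, \item $\mathcal{I}_{p}^{1}(F)<\infty$ for all $p\in(0,\infty)$, \item $\mathcal{M}_{p}^{1}(F)<\infty$ for all $p\in(0,\infty)$. \end{itemize}
   Context: $\mathcal{H}^1$ is the one-dimensional Hausdorff measure. For mutually distinct points $x,y,z$ let $r(x,y,z)\in(0,\infty]$ be the circumradius of the triangle with these vertices ($r=\infty$ if the points are collinear). Conventions: $1/0=\infty$, $1/\infty=0$, $\inf\emptyset=\infty$. For a set $X$: the thickness is $\Delta[X]=\inf\{r(u,v,w):u,v,w\in X\text{ mutually distinct}\}$; $\kappa(x,y,z)=1/r(x,y,z)$ if $x,y,z\in X$ are mutually distinct and $0$ otherwise; $\kappa_i(x,y)=1/\inf_{w\in X\setminus\{x,y\}} r(x,y,w)$ if $x\neq y$ and $\kappa_i(x,x)=0$; $\kappa_G(x)=1/\inf\{r(x,v,w): v,w\in X,\ x,v,w\text{ mutually distinct}\}$. For $p\in(0,\infty)$: $\mathcal{U}_p^{1}(X)=\int_X\kappa_G^p\,d\mathcal{H}^1$,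 $\mathcal{I}_p^{1}(X)=\int_X\int_X\kappa_i^p(x,y)\,d\mathcal{H}^1(x)d\mathcal{H}^1(y)$, $\mathcal{M}_p^{1}(X)=\int_X\int_X\int_X\kappa^p(x,y,z)\,d\mathcal{H}^1(x)d\mathcal{H}^1(y)d\mathcal{H}^1(z)$. For $s\in\mathbb{S}^{n-1}$, $\epsilon>0$ the open double cone is $C_{s,\epsilon}(x)=\{y\in\mathbb{R}^n\setminus\{x\}:\min\{\measuredangle(y,x,x-s),\measuredangle(y,x,x+s)\}<\epsilon\}$, where $\measuredangle(y,x,z)$ is the angle at $x$. A set $X\subset\mathbb{R}^n$ has an approximate $1$-tangent at $x$ if there is $s\in\mathbb{S}^{n-1}$ such that $\lim_{r\downarrow0}\mathcal{H}^1([X\setminus C_{s,\epsilon}(x)]\cap\overline B_r(x))/(2r)=0$ for all $\epsilon>0$, where $\overline B_r(x)$ is the closed ball. *)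

(* Defs.v *)
From HB Require Import structures.
From mathcomp Require Import all_boot all_order all_algebra.
From mathcomp Require Import all_classical all_reals all_analysis.
Set Implicit Arguments.
Unset Strict Implicit.
Unset Printing Implicit Defensive.
Import Order.TTheory GRing.Theory Num.Theory.
Import numFieldNormedType.Exports.

Local Open Scope classical_set_scope.
Local Open Scope ring_scope.

(* The library norm on 'rV[R]_n is the sup norm, so R^n gets its Euclidean
   geometry here. *)
Section euclidean.
Context {R : realType} {n : nat}.
Implicit Types (x y z : 'rV[R]_n) (A : set 'rV[R]_n).

Definition eucl_dot x y : R := \sum_i x 0 i * y 0 i.

Definition eucl_norm x : R := Num.sqrt (eucl_dot x x).

Definition eucl_dist x y : R := eucl_norm (x - y).

Definition eucl_closed_ball x (r : R) : set 'rV[R]_n := [set y | eucl_dist y x <= r].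

(* The angle at x between the directions y - x and z - x, in [0, pi]. *)
Definition angle y x z : R :=
  acos (eucl_dot (y - x) (z - x) / (eucl_norm (y - x) * eucl_norm (z - x))).

(* 0 is thrown in because ereal_sup set0 = -oo, whereas diam(empty) = 0. *)
Definition eucl_diam A : \bar R :=
  ereal_sup (0%E |` [set (eucl_dist x y)%:E | x in A & y in A]).

End euclidean.

(* One-dimensional Hausdorff measure, normalized by the diameter (so that a
   segment has its length as measure): an outer measure, defined on all sets. *)
Section hausdorff1.
Context (R : realType) (n : nat).
Local Notation V := 'rV[R]_n.
Implicit Types (A B : set V).
Local Open Scope ereal_scope.

Definition delta_cover (delta : R) A : set ((set V)^nat) :=
  [set U | A `<=` \bigcup_k U k /\ forall k, eucl_diam (U k) <= delta%:E].

Definition hausdorff1_delta (delta : R) A : \bar R :=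
  ereal_inf [set \sum_(k <oo) eucl_diam (U k) | U in delta_cover delta A].

Definition hausdorff1 A : \bar R :=
  ereal_sup [set hausdorff1_delta delta A | delta in [set d | (0 < d)%R]].

Lemma eucl_diam_ge0 A : 0 <= eucl_diam A.
Proof. by apply: ereal_sup_ubound; left. Qed.

Lemma eucl_diam0 : eucl_diam (set0 : set V) = 0.
Proof.
apply/eqP; rewrite eq_le eucl_diam_ge0 andbT.
by apply: ge_ereal_sup => _ [->//|[x []]].
Qed.

Lemma hausdorff1_delta_ge0 delta A : 0 <= hausdorff1_delta delta A.
Proof.
apply: le_ereal_inf_tmp => _ [U _ <-].
by apply: nneseries_ge0 => k _ _; exact: eucl_diam_ge0.
Qed.

Lemma hausdorff1_delta_sigma_subadditive delta :
  sigma_subadditive (hausdorff1_delta delta).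
Proof.
move=> A; have [[i ioo]|] := pselect (exists i, hausdorff1_delta delta (A i) = +oo).
  rewrite (eseries_pinfty _ _ ioo)// ?leey// => k _.
  by rewrite -ltNye (lt_le_trans _ (hausdorff1_delta_ge0 _ _)).
rewrite -forallNE => Aoo.
apply/lee_addgt0Pr => _/posnumP[e].
apply: (le_trans _ (epsilon_trick xpredT _ _)) => //; last first.
  by move=> k; exact: hausdorff1_delta_ge0.
have [G PG] : {G : ((set V)^nat)^nat & forall k, delta_cover delta (A k) (G k) /\
    \sum_(j <oo) eucl_diam (G k j) <=
      hausdorff1_delta delta (A k) + (e%:num / (2 ^ k.+1)%:R)%:E}.
  apply: (@choice _ _ (fun k U => delta_cover delta (A k) U /\
    \sum_(j <oo) eucl_diam (U j) <=
      hausdorff1_delta delta (A k) + (e%:num / (2 ^ k.+1)%:R)%:E)) => k.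
  have en1 : (0 < e%:num / (2 ^ k.+1)%:R)%R by [].
  have Afin : hausdorff1_delta delta (A k) \is a fin_num.
    by rewrite ge0_fin_numE ?hausdorff1_delta_ge0// ltey; apply/eqP; exact: Aoo.
  have [_ [U Ucov <-] /ltW Ule] := lb_ereal_inf_adherent en1 Afin.
  by exists U.
have G_ge0 x : 0 <= (@eucl_diam R n \o uncurry G) x by exact: eucl_diam_ge0.
apply: (@le_trans _ _ (\esum_(i in setT) (@eucl_diam R n \o uncurry G) i)).
  apply: ereal_inf_lbound => /=.
  have /card_esym/ppcard_eqP[f] := card_nat2.
  exists (uncurry G \o f).
    split => [|k]; last first.
      by have /(_ (f k).2) := (PG (f k).1).1.2; rewrite /= /uncurry; case: (f k).
    move=> t [i _] /((PG i).1.1)[j _ Gijt]; exists (f^-1%FUN (i, j)) => //=.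
    by rewrite invK ?inE.
  rewrite -(esum_pred_image (@eucl_diam R n \o uncurry G) _ xpredT) ?[fun=> _]set_true//.
  by rewrite image_eq.
rewrite (_ : esum _ _ = \sum_(i <oo) \sum_(j <oo) eucl_diam (G i j)); last first.
  pose J : nat -> set (nat * nat) := fun i => [set (i, j) | j in setT].
  rewrite (_ : setT = \bigcup_k J k); last first.
    by rewrite predeqE => -[a b]; split => // _; exists a => //; exists b.
  rewrite esum_bigcupT /=; last 2 first.
    - apply/trivIsetP => i j _ _ ij.
      rewrite predeqE => -[a b] /=; split => //= -[] [_] _ [<-{a} _].
      by move=> [m' _] [] /esym/eqP; rewrite (negbTE ij).
    - by move=> /= [a b]; exact: eucl_diam_ge0.
  rewrite -(image_id [set: nat]) -fun_true esum_pred_image//; last first.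
    by move=> k _; apply: esum_ge0 => ? _; exact: eucl_diam_ge0.
  apply: eq_eseriesr => /= j _.
  rewrite -(esum_pred_image (@eucl_diam R n \o uncurry G) (pair j) predT)//=.
  - by congr esum; rewrite predeqE => -[a b]; split; move=> [i _ <-]; exists i.
  - by move=> k _; exact: eucl_diam_ge0.
  - by move=> ? ? _ _; exact: (@can_inj _ _ _ snd).
apply: lee_nneseries => i *; last exact: (PG i).2.
by apply: nneseries_ge0 => j *; exact: eucl_diam_ge0.
Qed.

Lemma hausdorff1_ge0 A : 0 <= hausdorff1 A.
Proof.
apply: (le_trans (hausdorff1_delta_ge0 1 A)).
by apply: ereal_sup_ubound; exists 1%R => //=.
Qed.

Lemma hausdorff1_set0 : hausdorff1 set0 = 0.
Proof.
apply/eqP; rewrite eq_le hausdorff1_ge0 andbT.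
apply: ge_ereal_sup => _ [d /= d0 <-]; apply: ereal_inf_lbound.
exists (fun=> set0).
  by split => // k; rewrite eucl_diam0 lee_fin ltW.
by apply: eseries0 => *; exact: eucl_diam0.
Qed.

Lemma le_hausdorff1 : {homo hausdorff1 : A B / A `<=` B >-> A <= B}.
Proof.
move=> A B AB; apply: ge_ereal_sup => _ [d /= d0 <-].
apply: (@le_trans _ _ (hausdorff1_delta d B)); last first.
  by apply: ereal_sup_ubound; exists d.
apply: ereal_inf_le_tmp => _ [U [BU Ud] <-]; exists U => //; split => //.
exact: subset_trans BU.
Qed.

Lemma hausdorff1_sigma_subadditive : sigma_subadditive hausdorff1.
Proof.
move=> A; apply: ge_ereal_sup => _ [d /= d0 <-].
apply: (le_trans (@hausdorff1_delta_sigma_subadditive d A)).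
apply: lee_nneseries => [*|k _]; first exact: hausdorff1_delta_ge0.
by apply: ereal_sup_ubound; exists d.
Qed.

HB.instance Definition _ := isOuterMeasure.Build R V hausdorff1
  hausdorff1_set0 hausdorff1_ge0 le_hausdorff1 hausdorff1_sigma_subadditive.

End hausdorff1.

(* R^n with the sigma-algebra of the Caratheodory measurable sets of H^1, on
   which H^1 is a measure. An alias, so that it does not interfere with other
   structures on 'rV[R]_n. *)
Definition H1space (R : realType) (n : nat) : Type := 'rV[R]_n.

Definition H1 {R : realType} {n : nat} : set (H1space R n) -> \bar R :=
  @hausdorff1 R n.

Section H1_measure.
Context (R : realType) (n : nat).
Let mu : {outer_measure set 'rV[R]_n -> \bar R} := @hausdorff1 R n.

HB.instance Definition _ := Pointed.copy (H1space R n) (matrix R 1 n).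
HB.instance Definition _ :=
  @isMeasurable.Build (caratheodory_display (@H1 R n)) (H1space R n)
    (@H1 R n).-caratheodory
    (caratheodory_measurable_set0 mu)
    (@caratheodory_measurable_setC _ _ mu)
    (@caratheodory_measurable_bigcup _ _ mu).

Lemma H1_sigma_additive : semi_sigma_additive (@H1 R n).
Proof.
pose T : pointedType := H1space R n.
pose mu' : {outer_measure set T -> \bar R} := mu.
exact: (@caratheodory_measure_sigma_additive R T mu').
Qed.

HB.instance Definition _ := isMeasure.Build _ (H1space R n) R (@H1 R n)
  (@hausdorff1_set0 R n) (@hausdorff1_ge0 R n) H1_sigma_additive.

End H1_measure.

Section curvature.
Context {R : realType} {n : nat}.
Implicit Types (x y z : 'rV[R]_n) (X : set 'rV[R]_n).

Definition distinct3 x y z : bool := [&& x != y, y != z & x != z].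

Definition collinear x y z : Prop :=
  exists p v, forall u, [set x; y; z] u -> exists t : R, u = p + t *: v.

(* The radii of the circles through x, y, z; as a circle lies in the plane of
   the triangle, its center c belongs to the affine hull of x, y, z. For points
   that are not collinear there is exactly one such radius. *)
Definition circumscribed_radii x y z : set R :=
  [set rho | exists c, (exists a b : R, c = x + a *: (y - x) + b *: (z - x)) /\
    [/\ eucl_dist x c = rho, eucl_dist y c = rho & eucl_dist z c = rho]].

Definition circumradius x y z : \bar R :=
  if `[< collinear x y z >] then +oo%E
  else (get (circumscribed_radii x y z))%:E.

(* In \bar R, 0^-1 = +oo, +oo^-1 = 0 and ereal_inf set0 = +oo. *)
Local Open Scope ereal_scope.

Definition thickness X : \bar R :=
  ereal_inf [set r | exists u v w,
    [/\ X u, X v, X w & distinct3 u v w] /\ r = circumradius u v w].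

Definition kappa x y z : \bar R :=
  if distinct3 x y z then 1 / circumradius x y z else 0.

Definition kappa_i X x y : \bar R :=
  if x == y then 0
  else 1 / ereal_inf [set circumradius x y w | w in X `\` [set x; y]].

Definition kappa_G X x : \bar R :=
  1 / ereal_inf [set r | exists v w,
    [/\ X v, X w & distinct3 x v w] /\ r = circumradius x v w].

Definition energyU (p : R) X : \bar R :=
  \int[H1]_(x in (X : set (H1space R n))) (kappa_G X x `^ p).

Definition energyI (p : R) X : \bar R :=
  \int[H1]_(y in (X : set (H1space R n)))
  \int[H1]_(x in (X : set (H1space R n))) (kappa_i X x y `^ p).

Definition energyM (p : R) X : \bar R :=
  \int[H1]_(z in (X : set (H1space R n)))
  \int[H1]_(y in (X : set (H1space R n)))
  \int[H1]_(x in (X : set (H1space R n))) (kappa x y z `^ p).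

End curvature.

Section approximate_tangent.
Context {R : realType} {n : nat}.
Implicit Types (s x : 'rV[R]_n) (X : set 'rV[R]_n).

Definition double_cone s (eps : R) x : set 'rV[R]_n :=
  [set y | y != x /\ Num.min (angle y x (x - s)) (angle y x (x + s)) < eps].

Definition has_approx_tangent X x : Prop :=
  exists s, eucl_norm s = 1 /\ forall eps : R, 0 < eps ->
    (hausdorff1 ((X `\` double_cone s eps x) `&` eucl_closed_ball x r) / (2 * r)%:E)%E
      @[r --> 0^'+] --> 0%E.

End approximate_tangent.

Section the_set_F.
Context (R : realType).

Definition seq_a (n : nat) : R := 2 ^- (n ^ n * n ^ 3)%N.

Definition seq_A (n : nat) : set R := `[seq_a n / 2, seq_a n]%classic.

Definition plane_prod (A B : set R) : set 'rV[R]_2 :=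
  [set z | A (z 0 0) /\ B (z 0 1)].

Definition setF : set 'rV[R]_2 :=
  (\bigcup_(n in [set m | (0 < m)%N]) plane_prod (seq_A (2 * n)) [set 0]) `|`
  (\bigcup_(n in [set m | (0 < m)%N]) plane_prod [set 0] (seq_A (2 * n - 1))).

End the_set_F.

Arguments setF : clear implicits.

(* Main.v *)
Require Import Defs.
From mathcomp Require Import all_boot all_order all_algebra.
From mathcomp Require Import all_classical all_reals all_analysis.
From mathcomp Require Import measurable_realfun ring lra zify.
Set Implicit Arguments.
Unset Strict Implicit.
Unset Printing Implicit Defensive.
Import Order.TTheory GRing.Theory Num.Theory.
Import numFieldNormedType.Exports.
Local Open Scope classical_set_scope.
Local Open Scope ring_scope.

(* Write S_n for the segment of F coming from A_n and a_0 = 1. Two points of S_m and S_n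
   with m < n are at distance at least a_m / 4; for two points x, y of the same S_n only a
   third point w on the other axis matters, and the circumcenter of (s,0), (t,0), (0,c) has
   second coordinate (c + st/c)/2, which is large whether c is much larger or much smaller
   than a_n. Hence kappa_i(x, y) <= 8 / a_(max(m,n)-1), so that, for an integer P >= p,
   kappa_i(x, y)^p <= g(x) g(y) with g = (8 / a_(n-1))^P on S_n. As a_n decreases so fast
   that g is integrable, I_p <= (int g)^2 and, since kappa <= kappa_i, M_p <= (int g)^3.
   On the other hand, x in S_n together with two points of S_(n+1) spans a circle of
   radius at most 2 a_n: the thickness vanishes, and every S_n contributes at least a
   fixed amount to U_p when p >= 1. Finally F has density at least 1/4 at 0 along the
   radii a_n on each axis, and a double cone of small aperture misses one of the axes. *)

(** * Euclidean inner product, norm and distance *)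

Section euclidean.
Context {R : realType} {n : nat}.
Implicit Types (x y z u v : 'rV[R]_n).

Lemma eucl_dotC u v : eucl_dot u v = eucl_dot v u.
Proof. by apply: eq_bigr => i _; rewrite mulrC. Qed.

Lemma eucl_dotDl u v x : eucl_dot (u + v) x = eucl_dot u x + eucl_dot v x.
Proof. by rewrite -big_split; apply: eq_bigr => i _; rewrite mxE mulrDl. Qed.

Lemma eucl_dotZl (a : R) u x : eucl_dot (a *: u) x = a * eucl_dot u x.
Proof. by rewrite /eucl_dot mulr_sumr; apply: eq_bigr => i _; rewrite mxE mulrA. Qed.

Lemma eucl_dotNl u x : eucl_dot (- u) x = - eucl_dot u x.
Proof. by rewrite -scaleN1r eucl_dotZl mulN1r. Qed.

Lemma eucl_dotDr u v x : eucl_dot x (u + v) = eucl_dot x u + eucl_dot x v.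
Proof. by rewrite !(eucl_dotC x) eucl_dotDl. Qed.

Lemma eucl_dotZr (a : R) u x : eucl_dot x (a *: u) = a * eucl_dot x u.
Proof. by rewrite !(eucl_dotC x) eucl_dotZl. Qed.

Lemma eucl_dotNr u x : eucl_dot x (- u) = - eucl_dot x u.
Proof. by rewrite !(eucl_dotC x) eucl_dotNl. Qed.

Definition eucl_dotE :=
  (eucl_dotDl, eucl_dotDr, eucl_dotNl, eucl_dotNr, eucl_dotZl, eucl_dotZr).

Lemma eucl_dot_ge0 u : 0 <= eucl_dot u u.
Proof. by apply: sumr_ge0 => i _; rewrite -expr2 sqr_ge0. Qed.

Lemma eucl_dot_eq0 u : (eucl_dot u u == 0) = (u == 0).
Proof.
apply/idP/eqP => [|->]; last by rewrite /eucl_dot big1// => i _; rewrite mxE mul0r.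
rewrite psumr_eq0 => [/allP u0|i _]; last by rewrite -expr2 sqr_ge0.
apply/rowP => i; rewrite mxE; apply/eqP.
by have := u0 i; rewrite mem_index_enum mulf_eq0 orbb => /(_ isT).
Qed.

Lemma eucl_norm_ge0 u : 0 <= eucl_norm u.
Proof. exact: sqrtr_ge0. Qed.

Lemma eucl_norm_sqr u : eucl_norm u ^+ 2 = eucl_dot u u.
Proof. by rewrite sqr_sqrtr// eucl_dot_ge0. Qed.

Lemma eucl_dist_ge0 x y : 0 <= eucl_dist x y.
Proof. exact: eucl_norm_ge0. Qed.

Lemma eucl_dist_sqr x y : eucl_dist x y ^+ 2 = \sum_i (x 0 i - y 0 i) ^+ 2.
Proof. by rewrite eucl_norm_sqr; apply: eq_bigr => i _; rewrite !mxE expr2. Qed.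

Lemma eucl_distC x y : eucl_dist x y = eucl_dist y x.
Proof.
by rewrite /eucl_dist /eucl_norm -opprB eucl_dotNl eucl_dotNr opprK.
Qed.

Lemma eucl_distxx x : eucl_dist x x = 0.
Proof. by rewrite /eucl_dist /eucl_norm subrr -(scale0r 0) eucl_dotZl mul0r sqrtr0. Qed.

Lemma coord_le_eucl_dist x y i : `|x 0 i - y 0 i| <= eucl_dist x y.
Proof.
rewrite -(@ler_pXn2r _ 2)// ?nnegrE ?eucl_dist_ge0// real_normK ?num_real//.
rewrite eucl_dist_sqr (bigD1 i)//= lerDl.
by apply: sumr_ge0 => j _; exact: sqr_ge0.
Qed.

(* The parallelogram identity replaces the triangle inequality. *)
Lemma eucl_dist_le_2radius x y c (r : R) :
  eucl_dist x c = r -> eucl_dist y c = r -> eucl_dist x y <= 2 * r.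
Proof.
move=> xr yr; have r0 : 0 <= r by rewrite -xr eucl_dist_ge0.
rewrite -(@ler_pXn2r _ 2)// ?nnegrE ?eucl_dist_ge0 ?mulr_ge0//.
have -> : eucl_dist x y ^+ 2 =
    2 * eucl_dist x c ^+ 2 + 2 * eucl_dist y c ^+ 2 -
    eucl_dot (x + y - 2 *: c) (x + y - 2 *: c).
  rewrite !eucl_norm_sqr !eucl_dotE (eucl_dotC y x) (eucl_dotC c x) (eucl_dotC c y).
  by ring.
rewrite xr yr; have := eucl_dot_ge0 (x + y - 2 *: c).
by set d := eucl_dot _ _ => d0; nra.
Qed.

End euclidean.

(** * Existence of circumcenters and first bounds on the circumradius *)

Section circumradius.
Context {R : realType} {n : nat}.
Implicit Types (x y z u v : 'rV[R]_n).

(** This is the equality case of Cauchy-Schwarz: if [v != 0], the component of [u] orthogonal to [v]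
    has norm zero. *)
Lemma collinear_gram0 x y z :
  eucl_dot (y - x) (y - x) * eucl_dot (z - x) (z - x) = eucl_dot (y - x) (z - x) ^+ 2 ->
  collinear x y z.
Proof.
set u := y - x; set v := z - x => uv.
have yE : y = x + u by rewrite addrC subrK.
have zE : z = x + v by rewrite addrC subrK.
clearbody u v.
have [v0|v0] := eqVneq v 0.
  exists x, u => w /= [[->|->]|->].
  - by exists 0; rewrite scale0r addr0.
  - by exists 1; rewrite scale1r.
  - by exists 0; rewrite scale0r addr0 zE v0 addr0.
have vv0 : eucl_dot v v != 0 by rewrite eucl_dot_eq0.
exists x, v => w /= [[->|->]|->].
- by exists 0; rewrite scale0r addr0.
- exists (eucl_dot u v / eucl_dot v v); rewrite {1}yE; congr (_ + _).
  apply/eqP; rewrite -subr_eq0 -eucl_dot_eq0.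
  set t := _ / _; have tE : t * eucl_dot v v = eucl_dot u v by rewrite divfK.
  have -> : eucl_dot (u - t *: v) (u - t *: v) = eucl_dot u u - t * eucl_dot u v.
    by rewrite !eucl_dotE (eucl_dotC v u) tE; ring.
  by rewrite -(inj_eq (mulIf vv0)) mul0r mulrBl uv mulrAC tE expr2 subrr.
- by exists 1; rewrite scale1r.
Qed.

(** Guarantees that [get] in [circumradius] picks a genuine radius. The center is [x + w], where [a]
    and [b] solve [2 w.u = u.u], [2 w.v = v.v] by Cramer's rule; the Gram determinant is nonzero off
    the collinear case. *)
Lemma circumscribed_radii_nonempty x y z :
  ~ collinear x y z -> circumscribed_radii x y z !=set0.
Proof.
move=> ncol; have := contra_not (@collinear_gram0 x y z) ncol; move: ncol => _.
set u := y - x; set v := z - x.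
have yE : y = x + u by rewrite addrC subrK.
have zE : z = x + v by rewrite addrC subrK.
rewrite /circumscribed_radii /= -/u -/v; clearbody u v.
set uu := eucl_dot u u; set vv := eucl_dot v v; set uv := eucl_dot u v => D0.
have {}D0 : uu * vv - uv ^+ 2 != 0 by apply/eqP => /subr0_eq.
pose a := vv * (uu - uv) / (2 * (uu * vv - uv ^+ 2)).
pose b := uu * (vv - uv) / (2 * (uu * vv - uv ^+ 2)).
pose w := a *: u + b *: v; pose c := x + w.
have wE : w = a *: u + b *: v by [].
have cE : c = x + w by [].
clearbody w c; exists (eucl_dist x c), c; split; first by exists a, b; rewrite -addrA -wE.
have wu : 2 * eucl_dot w u = uu.
  by rewrite wE !eucl_dotE (eucl_dotC v u) -/uu -/uv /a /b; field.
have wv : 2 * eucl_dot w v = vv.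
  by rewrite wE !eucl_dotE -/vv -/uv /a /b; field.
have xc : x - c = - w by rewrite cE opprD addrA subrr sub0r.
have yc : y - c = u - w by rewrite yE cE opprD addrACA subrr add0r.
have zc : z - c = v - w by rewrite zE cE opprD addrACA subrr add0r.
split => //; rewrite /eucl_dist /eucl_norm ?yc ?zc xc; congr Num.sqrt.
- rewrite !eucl_dotE (eucl_dotC u w) -/uu -{1}wu; ring.
- rewrite !eucl_dotE (eucl_dotC v w) -/vv -{1}wv; ring.
Qed.

Lemma circumradiusP x y z : ~ collinear x y z ->
  exists2 r, circumradius x y z = r%:E & circumscribed_radii x y z r.
Proof.
move=> xyz; exists (get (circumscribed_radii x y z)).
  by rewrite /circumradius; case: asboolP.
by have [r xyzr] := circumscribed_radii_nonempty xyz; apply: getI xyzr.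
Qed.

Lemma circumradius_ge0 x y z : (0 <= circumradius x y z)%E.
Proof.
have [xyz|/circumradiusP[r -> [c [_ [<- _ _]]]]] := pselect (collinear x y z).
  by rewrite /circumradius; case: asboolP => // _; exact: leey.
by rewrite lee_fin eucl_dist_ge0.
Qed.

Lemma eucl_dist_le_circumradius x y z :
  ((eucl_dist x y / 2)%:E <= circumradius x y z)%E.
Proof.
have [xyz|/circumradiusP[r -> [c [_ [xc yc _]]]]] := pselect (collinear x y z).
  by rewrite /circumradius; case: asboolP => // _; exact: leey.
by rewrite lee_fin ler_pdivrMr// mulrC (eucl_dist_le_2radius xc yc).
Qed.

End circumradius.

(** * Additivity of [hausdorff1] on separated sets and Caratheodory measurability *)

Section hausdorff_caratheodory.
Context {R : realType} {n : nat}.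
Implicit Types (A X Y : set 'rV[R]_n) (phi : 'rV[R]_n -> R).
Local Open Scope ereal_scope.

Lemma eucl_dist_le_diam A x y : A x -> A y -> (eucl_dist x y)%:E <= eucl_diam A.
Proof. by move=> Ax Ay; apply: ereal_sup_ubound; right; exists x => //; exists y. Qed.

Lemma eucl_diam_le A (d : R) : (0 <= d)%R ->
  (forall x y, A x -> A y -> eucl_dist x y <= d)%R -> eucl_diam A <= d%:E.
Proof.
move=> d0 Ad; apply: ge_ereal_sup => _ [->|[x Ax [y Ay <-]]]; rewrite lee_fin//.
exact: Ad.
Qed.

Lemma hausdorff1_delta_nincr A (d e : R) : (d <= e)%R ->
  hausdorff1_delta e A <= hausdorff1_delta d A.
Proof.
move=> de; apply: ereal_inf_le_tmp => _ [U [AU Ud] <-]; exists U => //; split=> // k.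
by rewrite (le_trans (Ud k))// lee_fin.
Qed.

Lemma hausdorff1_delta_le A (d : R) : (0 < d)%R -> hausdorff1_delta d A <= hausdorff1 A.
Proof. by move=> d0; apply: ereal_sup_ubound; exists d. Qed.

(* No set of diameter less than [t - s] meets both [X] and [Y]. *)
Lemma hausdorff1_delta_separated phi X Y (s t d : R) :
  (forall x y, phi x - phi y <= eucl_dist x y)%R ->
  (d < t - s)%R -> (forall x, X x -> phi x <= s)%R -> (forall y, Y y -> t <= phi y)%R ->
  hausdorff1_delta d X + hausdorff1_delta d Y <= hausdorff1_delta d (X `|` Y).
Proof.
move=> phi1 dst Xs Yt; apply: le_ereal_inf_tmp => _ [U [XYU Ud] <-].
(* [V Z] keeps the covering sets that meet [Z] and empties the others; no [U k] is kept for both [X]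
   and [Y]. *)
pose V Z k := if `[< U k `&` Z !=set0 >] then U k else set0.
have VU Z k : eucl_diam (V Z k) <= eucl_diam (U k).
  by rewrite /V; case: ifP => // _; rewrite eucl_diam0 eucl_diam_ge0.
have Vcov Z : Z `<=` X `|` Y -> delta_cover d Z (V Z).
  move=> ZXY; split=> [z Zz|k]; last exact: le_trans (VU _ _) (Ud k).
  have [k _ Ukz] := XYU _ (ZXY _ Zz); exists k => //.
  by rewrite /V; case: asboolP => // -[]; exists z.
apply: (@le_trans _ _ (\sum_(k <oo) eucl_diam (V X k) + \sum_(k <oo) eucl_diam (V Y k))).
  apply: leeD; apply: ereal_inf_lbound.
  - by exists (V X) => //; apply: Vcov; exact: subsetUl.
  - by exists (V Y) => //; apply: Vcov; exact: subsetUr.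
rewrite -nneseriesD; [|by move=> *; exact: eucl_diam_ge0..].
apply: lee_nneseries => [k _ _|k _]; first by rewrite adde_ge0 ?eucl_diam_ge0.
rewrite /V; case: asboolP => [[x [Ux Xx]]|_]; case: asboolP => [[y [Uy Yy]]|_];
  rewrite ?eucl_diam0 ?adde0 ?add0e ?eucl_diam_ge0//.
have := le_trans (eucl_dist_le_diam Uy Ux) (Ud k); rewrite lee_fin => yx.
by exfalso; have := Xs _ Xx; have := Yt _ Yy; have := phi1 y x; lra.
Qed.

Lemma hausdorff1_separated phi X Y (s t : R) :
  (forall x y, phi x - phi y <= eucl_dist x y)%R ->
  (s < t)%R -> (forall x, X x -> phi x <= s)%R -> (forall y, Y y -> t <= phi y)%R ->
  hausdorff1 X + hausdorff1 Y <= hausdorff1 (X `|` Y).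
Proof.
move=> phi1 st Xs Yt.
have [->|] := eqVneq (hausdorff1 (X `|` Y)) +oo; first exact: leey.
rewrite -ltey -ge0_fin_numE ?hausdorff1_ge0// => XYfin.
have fin Z : Z `<=` X `|` Y -> hausdorff1 Z \is a fin_num.
  move=> /le_hausdorff1 ZXY; rewrite ge0_fin_numE ?hausdorff1_ge0//.
  by rewrite (le_lt_trans ZXY)// -ge0_fin_numE ?hausdorff1_ge0.
have Xfin := fin _ (@subsetUl _ X Y); have Yfin := fin _ (@subsetUr _ X Y).
rewrite -leeBrDr//; apply: ge_ereal_sup => _ [d /= d0 <-].
rewrite leeBrDr//; have dfin : hausdorff1_delta d X \is a fin_num.
  rewrite ge0_fin_numE ?hausdorff1_delta_ge0// (le_lt_trans (hausdorff1_delta_le _ d0))//.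
  by rewrite -ge0_fin_numE ?hausdorff1_ge0.
rewrite -leeBrDl//; apply: ge_ereal_sup => _ [e /= e0 <-]; rewrite leeBrDl//.
(* One scale below [d], [e] and the gap [t - s] serves both premeasures, since they grow as the
   scale shrinks. *)
pose m : R := Num.min (Num.min d e) ((t - s) / 2)%R.
have m0 : (0 < m)%R by rewrite !lt_min d0 e0 divr_gt0// subr_gt0.
have md : (m <= d)%R by rewrite !ge_min lexx.
have me : (m <= e)%R by rewrite !ge_min lexx orbT.
have mst : (m < t - s)%R.
  have : (m <= (t - s) / 2)%R by rewrite !ge_min lexx orbT.
  by lra.
apply: le_trans (leeD (hausdorff1_delta_nincr _ md) (hausdorff1_delta_nincr _ me)) _.
exact: le_trans (hausdorff1_delta_separated phi1 mst Xs Yt) (hausdorff1_delta_le _ m0).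
Qed.

(* Caratheodory's criterion: the part of [A] outside [phi <= t] is exhausted by
   [phi >= tau k], up to thin shells. Shells of the same parity are separated, so
   their measures are summable and the tails of the two series vanish. *)
Lemma hausdorff1_caratheodory phi (t : R) :
  (forall x y, phi x - phi y <= eucl_dist x y)%R ->
  (@hausdorff1 R n).-caratheodory [set x | (phi x <= t)%R].
Proof.
move=> phi1.
pose mu : {outer_measure set 'rV[R]_n -> \bar R} := @hausdorff1 R n.
apply: (@le_caratheodory_measurable _ _ mu) => A.
have [->|] := eqVneq (mu A) +oo; first exact: leey.
rewrite -ltey => Afin.
pose tau k : R := (t + k.+1%:R^-1)%R.
have tauS k : (tau k.+1 < tau k)%R by rewrite ltrD2l ltf_pV2 ?posrE// ltr_nat.
have taut k : (t < tau k)%R by rewrite ltrDl invr_gt0.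
pose up k := A `&` [set x | (tau k <= phi x)%R].
pose B k := A `&` [set x | (tau k.+2 <= phi x <= tau k.+1)%R].
have tau_le k l : (k <= l)%N -> (tau l <= tau k)%R.
  by move=> kl; rewrite lerD2l lef_pV2 ?posrE// ler_nat.
(* The earlier shells lie in [up (N.*2 + b)], above [tau (N.*2 + b)], and the new one lies below
   [tau (N.*2 + b).+1]; this gap makes the measures add up. *)
have Bsum b N : \sum_(0 <= k < N) mu (B (k.*2 + b)%N) <= mu (up (N.*2 + b)%N).
  elim: N => [|N ih]; first by rewrite big_nil hausdorff1_ge0.
  rewrite big_nat_recr//= (le_trans (leeD2r _ ih))//.
  rewrite addeC (le_trans (hausdorff1_separated phi1 (tauS (N.*2 + b)%N) _ _))//.
  - by move=> x [_ /andP[]].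
  - by move=> x [].
  apply: le_hausdorff1 => x [|] [Ax /=]; rewrite doubleS !addSn.
    by case/andP.
  by move=> h; split=> //=; rewrite (le_trans _ h)// tau_le// !leqW.
have tail b : \sum_(N <= k <oo) mu (B (k.*2 + b)%N) @[N --> \oo] --> 0.
  apply: nneseries_tail_cvg => [|k _]; last exact: hausdorff1_ge0.
  apply: le_lt_trans Afin; apply: lime_le.
    by apply: is_cvg_nneseries => k _ _; exact: hausdorff1_ge0.
  apply: nearW => N; apply: le_trans (Bsum b N) _.
  by apply: le_hausdorff1 => x [].
have key N : mu (A `&` [set x | (phi x <= t)%R]) + mu (A `&` ~` [set x | (phi x <= t)%R])
    <= mu A + (\sum_(N <= k <oo) mu (B (k.*2 + 0)%N) + \sum_(N <= k <oo) mu (B (k.*2 + 1)%N)).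
  have split : A `&` ~` [set x | (phi x <= t)%R] `<=`
      up N.*2.+1 `|` (\bigcup_(k in ~` `I_N) B (k.*2 + 0)%N `|`
      \bigcup_(k in ~` `I_N) B (k.*2 + 1)%N).
    move=> x [Ax /negP]; rewrite -ltNge => tx.
    have [xN|xN] := leP (tau N.*2.+1) (phi x); first by left.
    have [k xk] : exists k, (tau k <= phi x)%R.
      have xt0 : (0 < phi x - t)%R by rewrite subr_gt0.
      exists (Num.truncn (phi x - t)^-1); rewrite -lerBrDl.
      rewrite -[leRHS]invrK lef_pV2 ?posrE ?invr_gt0//.
      exact: ltW (truncnS_gt _).
    (* For the first [m] with [tau m <= phi x], minimality puts [x] in the shell of index [m - 2],
       and [2 N + 1 < m] makes half of this index at least [N]. *)
    have [m xm mmin] := ex_minnP (ex_intro (fun k => tau k <= phi x)%R k xk).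
    have Nm : (N.*2.+1 < m)%N.
      by rewrite ltnNge; apply/negP => /tau_le; move: xm xN => /=; lra.
    right; case: m xm mmin Nm => [//|[//|m]] xm mmin Nm.
    have Bm : B m x.
      split => //=; rewrite xm/= leNgt; apply/negP => /ltW /mmin.
      by rewrite ltnn.
    have mE := odd_double_half m.
    have Nm2 : (N <= m./2)%N by lia.
    case: (odd m) mE => /= mE; [right|left]; exists m./2 => /=.
    - by apply/negP; rewrite -leqNgt.
    - by rewrite addnC mE.
    - by apply/negP; rewrite -leqNgt.
    - by rewrite addnC mE.
  apply: (@le_trans _ _ (mu (A `&` [set x | (phi x <= t)%R]) + (mu (up N.*2.+1) +
     (\sum_(N <= k <oo) mu (B (k.*2 + 0)%N) + \sum_(N <= k <oo) mu (B (k.*2 + 1)%N))))).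
    rewrite leeD2l// (le_trans (le_hausdorff1 split))//.
    rewrite (le_trans (outer_measureU2 mu _ _))// leeD2l//.
    rewrite (le_trans (outer_measureU2 mu _ _))//.
    by apply: leeD; exact: (outer_measure_sigma_subadditive_tail mu).
  rewrite addeA leeD2r// (le_trans (hausdorff1_separated phi1 (taut N.*2.+1) _ _))//.
  - by move=> x [].
  - by move=> x [].
  - by apply: le_hausdorff1 => x [[]|[]].
have lim : mu A + (\sum_(N <= k <oo) mu (B (k.*2 + 0)%N) +
    \sum_(N <= k <oo) mu (B (k.*2 + 1)%N)) @[N --> \oo] --> mu A.
  rewrite -[X in _ --> X]adde0 -[X in _ --> _ + X]adde0.
  apply: cvgeD; [by rewrite adde0 fin_num_adde_defl|exact: cvg_cst|].
  by apply: cvgeD; [rewrite fin_num_adde_defl|exact: tail..].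
rewrite -(cvg_lim _ lim)//; apply: lime_ge; first by apply/cvg_ex; exists (mu A).
exact: nearW.
Qed.

End hausdorff_caratheodory.

(** * Measurability and length of segments on the coordinate axes *)

Section axis_segment.
Context {R : realType} {n : nat}.
Implicit Types (i : 'I_n) (a b : R).

Definition axis_segment i a b : set 'rV[R]_n :=
  [set z | a <= z 0 i <= b /\ forall j, j != i -> z 0 j = 0].

Lemma eucl_dist_axis i (x y : 'rV[R]_n) :
  (forall j, j != i -> x 0 j = y 0 j) -> eucl_dist x y = `|x 0 i - y 0 i|.
Proof.
move=> xy; apply/eqP; rewrite -(@eqrXn2 _ 2)// ?eucl_dist_ge0//.
rewrite eucl_dist_sqr real_normK ?num_real// (bigD1 i)//= big1 ?addr0// => j ji.
by rewrite xy// subrr expr0n.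
Qed.

(** A coordinate is 1-Lipschitz for the Euclidean distance, so Caratheodory's criterion applies. *)
Lemma H1_measurable_le_coord i b :
  @measurable _ (H1space R n) [set z : 'rV[R]_n | z 0 i <= b].
Proof.
apply: (@hausdorff1_caratheodory R n (fun z : 'rV_n => z 0 i)) => x y.
exact: le_trans (ler_norm _) (coord_le_eucl_dist _ _ _).
Qed.

Lemma H1_measurable_ge_coord i a :
  @measurable _ (H1space R n) [set z : 'rV[R]_n | a <= z 0 i].
Proof.
rewrite (_ : [set _ | _] = [set z : 'rV[R]_n | - z 0 i <= - a]); last first.
  by apply/seteqP; split=> z /=; rewrite lerN2.
apply: (@hausdorff1_caratheodory R n (fun z : 'rV_n => - z 0 i)) => x y.
rewrite opprK addrC eucl_distC.
exact: le_trans (ler_norm _) (coord_le_eucl_dist _ _ _).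
Qed.

Lemma H1_measurable_axis_segment i a b :
  @measurable _ (H1space R n) (axis_segment i a b).
Proof.
pose Z j : set (H1space R n) :=
  [set z : 'rV[R]_n | z 0 j <= 0] `&` [set z : 'rV[R]_n | 0 <= z 0 j].
rewrite (_ : axis_segment i a b = [set z : 'rV[R]_n | a <= z 0 i] `&`
    [set z : 'rV[R]_n | z 0 i <= b] `&` \bigcap_(j in [set j | j != i]) Z j).
  apply: measurableI.
    by apply: measurableI; [exact: H1_measurable_ge_coord|exact: H1_measurable_le_coord].
  apply: fin_bigcap_measurable => [|j _]; first exact: finite_finset.
  by apply: measurableI; [exact: H1_measurable_le_coord|exact: H1_measurable_ge_coord].
apply/seteqP; split => z /=.
  by move=> [/andP[az zb] z0]; do !split => //=; rewrite z0.
move=> [[az zb] z0]; split=> [|j /z0[zj0 zj1]]; first by rewrite az.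
by apply/eqP; rewrite eq_le zj0.
Qed.

Lemma diam_axis_segment i a b : a <= b ->
  (eucl_diam (axis_segment i a b) <= (b - a)%:E)%E.
Proof.
move=> ab; apply: eucl_diam_le; first by rewrite subr_ge0.
move=> x y [/andP[? ?] x0] [/andP[? ?] y0].
rewrite (@eucl_dist_axis i); last by move=> j ji; rewrite x0// y0.
by rewrite ler_norml; apply/andP; split; lra.
Qed.

Lemma hausdorff1_axis_segment_le i a b : a < b ->
  (hausdorff1 (axis_segment i a b) <= (b - a)%:E)%E.
Proof.
move=> ab; apply: ge_ereal_sup => _ [d /= d0 <-].
(* [N] exceeds [(b - a) / d], so cutting into [N] equal pieces gives diameters at most [d]. *)
pose M := Num.truncn ((b - a) / d); pose N := M.+1.
pose h := (b - a) / N%:R.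
have ba0 : 0 < b - a by rewrite subr_gt0.
have h0 : 0 < h by rewrite divr_gt0.
have hd : h <= d.
  rewrite ler_pdivrMr// mulrC -ler_pdivrMr// ltW// /N.
  exact: truncnS_gt.
have Nh : N%:R * h = b - a by rewrite mulrC divfK// pnatr_eq0.
pose U k : set 'rV[R]_n :=
  if (k < N)%N then axis_segment i (a + k%:R * h) (a + k.+1%:R * h) else set0.
have U_le k : (eucl_diam (U k) <= h%:E)%E.
  rewrite /U; case: ifP => _; last by rewrite eucl_diam0 lee_fin ltW.
  rewrite (le_trans (diam_axis_segment _ _))//.
    by rewrite lerD2l ler_pM2r// ler_nat.
  by rewrite lee_fin -natr1; lra.
apply: (@le_trans _ _ (\sum_(k <oo) eucl_diam (U k))%E).
  apply: ereal_inf_lbound; exists U => //; split => [z [/andP[az zb] z0]|k]; last first.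
    by rewrite (le_trans (U_le k))// lee_fin.
  have xh : 0 <= (z 0 i - a) / h by rewrite divr_ge0 ?subr_ge0// ltW.
  have /andP[] := truncn_itv xh; set k := Num.truncn _.
  rewrite ler_pdivlMr// ltr_pdivrMr// => kz zk.
  have [kN|Nk] := ltnP k N.
    exists k => //; rewrite /U kN; split => //; apply/andP; split; lra.
  (* Only the right end [b] gives [k = N]; it belongs to the last piece, of index [M]. *)
  exists M => //; rewrite /U ltnSn; split => //.
  have : N%:R * h <= k%:R * h by rewrite ler_pM2r// ler_nat.
  by move: Nh; rewrite -natr1 => Mh kM; apply/andP; split; lra.
rewrite (nneseries_split 0 N); last by move=> k _; exact: eucl_diam_ge0.
rewrite [X in (_ + X)%E]eseries0 ?adde0; last first.
  by move=> k; rewrite add0n /U ltnNge => -> _ /=; exact: eucl_diam0.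
rewrite add0n -Nh (@le_trans _ _ (\sum_(0 <= k < N) h%:E)%E)//; first exact: lee_sum.
by rewrite sumEFin big_const_nat subn0 iter_addr_0 lee_fin mulr_natl.
Qed.

(** Each covering set projects to the axis into an interval as long as its diameter, and these
    intervals cover [[a, b]]; subadditivity of Lebesgue measure concludes. Scale [1] suffices and
    makes all diameters finite. *)
Lemma le_hausdorff1_axis_segment i a b :
  ((b - a)%:E <= hausdorff1 (axis_segment i a b))%E.
Proof.
have [ba|ab] := leP b a.
  by rewrite (@le_trans _ _ 0%E) ?hausdorff1_ge0// lee_fin subr_le0.
rewrite (le_trans _ (@hausdorff1_delta_le R n _ 1 _))//.
apply: le_ereal_inf_tmp => _ [U [segU Ud] <-].
pose d k := fine (eucl_diam (U k)).
have dE k : (d k)%:E = eucl_diam (U k).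
  by rewrite fineK// ge0_fin_numE ?eucl_diam_ge0// (le_lt_trans (Ud k))// ltey.
have d0 k : 0 <= d k by rewrite -lee_fin dE eucl_diam_ge0.
(* For an empty [U k] the infimum is a default value, and [I k] is then a single point. *)
pose m k := inf [set z 0 i | z in U k].
pose I k := `[m k, m k + d k]%classic.
have -> : ((b - a)%:E = @lebesgue_measure R `[a, b]%classic)%E.
  by rewrite lebesgue_measure_itv/= lte_fin ab EFinB.
have -> : (\sum_(k <oo) eucl_diam (U k) = \sum_(k <oo) @lebesgue_measure R (I k))%E.
  apply: eq_eseriesr => k _; rewrite lebesgue_measure_itv/= lte_fin -dE.
  rewrite ltrDl; case: ltgtP (d0 k) => // [_|<-//].
  by rewrite -EFinB addrAC subrr add0r.
apply: measure_sigma_subadditive => [k|//|t]; first exact: measurable_itv.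
rewrite /= in_itv/= => tab.
pose z : 'rV[R]_n := \row_j (if j == i then t else 0).
have [k _ Ukz] : (\bigcup_k U k) z.
  by apply: segU; split=> [|j ji]; rewrite mxE ?eqxx// (negbTE ji).
exists k => //; rewrite /I /= in_itv/=.
have zi : z 0 i = t by rewrite mxE eqxx.
have Uz w : U k w -> `|w 0 i - t| <= d k.
  move=> Ukw; rewrite -zi (le_trans (coord_le_eucl_dist _ _ _))// -lee_fin dE.
  exact: eucl_dist_le_diam.
apply/andP; split.
  apply: ge_inf; last by exists z.
  by exists (t - d k) => _ [w /Uz + <-]; rewrite ler_norml; lra.
rewrite -lerBlDr; apply: lb_le_inf; first by exists t, z.
by move=> _ [w /Uz + <-]; rewrite ler_norml; lra.
Qed.

End axis_segment.

(** * Growth of the exponents [n ^ n * n ^ 3] *)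

Section exponents.
Implicit Types n : nat.

(** In terms of the sequence this says [a (n+1) <= a n ^ (n+1)]: the decay eventually beats every
    fixed power of the previous term. *)
Lemma exponent_succ n : (n.+1 * (n ^ n * n ^ 3) <= n.+1 ^ n.+1 * n.+1 ^ 3)%N.
Proof.
rewrite (expnS _ n) -mulnA leq_pmul2l//.
by case: n => // n; rewrite leq_mul ?leq_exp2r.
Qed.

(** The surplus [2] becomes the factor 1/4 between consecutive terms of the sequence. *)
Lemma exponent_succD2 n : (0 < n)%N -> (n ^ n * n ^ 3 + 2 <= n.+1 ^ n.+1 * n.+1 ^ 3)%N.
Proof.
move=> n0; have nn0 : (0 < n ^ n)%N by rewrite expn_gt0 n0.
have nn : (n ^ n <= n.+1 ^ n.+1)%N.
  by rewrite (@leq_trans (n.+1 ^ n))// ?leq_exp2r// leq_exp2l//; lia.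
have n3 : (n ^ 3 + 2 <= n.+1 ^ 3)%N by rewrite !expnS !expn0; nia.
by rewrite (leq_trans _ (leq_mul nn n3))// mulnDr leq_add2l; lia.
Qed.

Lemma le_exponent n : (n <= n ^ n * n ^ 3)%N.
Proof.
case: n => // n; rewrite (expnS _ 2) mulnCA leq_pmulr//.
by rewrite muln_gt0 !expn_gt0.
Qed.

Lemma exponent_homo : {homo (fun n => n ^ n * n ^ 3)%N : m n / (m <= n)%N}.
Proof.
apply: homo_leq => [//|? ? ?|n]; first exact: leq_trans.
by apply: leq_trans (exponent_succ n); rewrite leq_pmull.
Qed.

End exponents.

(** * Decay of the sequence [seq_a] *)

Section seq_a.
Context {R : realType}.
Implicit Types m n : nat.
Local Notation a := (@seq_a R).

Lemma seq_aE n : a n = 2^-1 ^+ (n ^ n * n ^ 3)%N.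
Proof. by rewrite exprVn. Qed.

Lemma seq_a_gt0 n : 0 < a n.
Proof. by rewrite invr_gt0 exprn_gt0. Qed.

Lemma seq_a_nincr m n : (m <= n)%N -> a n <= a m.
Proof.
move=> mn; rewrite !seq_aE ler_wiXn2l ?invr_ge0 ?invf_le1 ?ler1n//.
exact: exponent_homo.
Qed.

Lemma seq_a0 : a 0 = 1. Proof. by rewrite seq_aE. Qed.

Lemma seq_a_le1 n : a n <= 1.
Proof. by rewrite -seq_a0; exact: seq_a_nincr. Qed.

Lemma seq_aS_le_quarter n : (0 < n)%N -> a n.+1 <= a n / 4.
Proof.
move=> /exponent_succD2 n2; rewrite (_ : a n / 4 = 2^-1 ^+ (n ^ n * n ^ 3 + 2)).
  by rewrite seq_aE ler_wiXn2l// ?invf_le1 ?ler1n ?invr_ge0.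
by rewrite exprD -seq_aE expr2; lra.
Qed.

(** Keeps the quotient [x y / w] of coordinates bounded below when [w] lies on a later segment than
    [x] and [y]. *)
Lemma seq_aS_le_sqr n : (0 < n)%N -> a n.+1 <= a n ^+ 2.
Proof.
move=> n0; rewrite !seq_aE -exprM ler_wiXn2l ?invf_le1 ?ler1n ?invr_ge0//.
by rewrite (leq_trans _ (exponent_succ n))// mulnC leq_pmul2r ?ltnS// muln_gt0 !expn_gt0 n0.
Qed.

Lemma seq_a_lt_quarter m n : (0 < m < n)%N -> a n <= a m / 4.
Proof.
by move=> /andP[m0 mn]; exact: le_trans (seq_a_nincr mn) (seq_aS_le_quarter m0).
Qed.

Lemma seq_a_le_expr n : a n <= 2^-1 ^+ n.
Proof. by rewrite seq_aE ler_wiXn2l ?invf_le1 ?ler1n ?invr_ge0// le_exponent. Qed.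

Lemma seq_a_lt (e : R) : 0 < e -> exists N, forall n, (N <= n)%N -> a n < e.
Proof.
move=> e0; exists (Num.truncn e^-1) => n Nn; apply: le_lt_trans (seq_a_le_expr n) _.
rewrite exprVn -[ltRHS]invrK ltf_pV2 ?posrE ?invr_gt0 ?exprn_gt0//.
rewrite (lt_le_trans (truncnS_gt _))// -natrX ler_nat.
by rewrite (leq_ltn_trans Nn)// ltn_expl.
Qed.

End seq_a.

(** * Decomposition of [setF] into segments on alternating axes, and circumcenters for points on
    both axes *)

Section segments.
Context {R : realType}.
Implicit Types (m n : nat) (x y z w v : 'rV[R]_2) (i j : 'I_2).
Local Notation a := (@seq_a R).
Local Notation F := (setF R).

Definition axis n : 'I_2 := if odd n then 1 else 0.

Definition segment n : set 'rV[R]_2 := axis_segment (axis n) (a n / 2) (a n).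

Lemma ord2_neq i j k : j != i -> k != i -> k = j.
Proof. case: i => -[|[|//]] ?; case: j => -[|[|//]] ?; case: k => -[|[|//]] ? //= _ _;
  exact/val_inj. Qed.

Lemma axis_succ n : axis n.+1 != axis n.
Proof. by rewrite /axis /=; case: (odd n). Qed.

Lemma axis_segment_plane_prod i (s t : R) : axis_segment i s t =
  if i == 0 then plane_prod `[s, t]%classic [set 0] else plane_prod [set 0] `[s, t]%classic.
Proof.
apply/seteqP; split => z.
  case: i => -[|[|//]] i2; rewrite /plane_prod /axis_segment /= !in_itv/=.
    rewrite (_ : Ordinal i2 = 0); last exact/val_inj.
    by move=> [-> ->].
  rewrite (_ : Ordinal i2 = 1); last exact/val_inj.
  by move=> [-> ->].
case: i => -[|[|//]] i2; rewrite /plane_prod /axis_segment /= !in_itv/=.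
  rewrite (_ : Ordinal i2 = 0); last exact/val_inj.
  by move=> [-> z1]; split => // j j0; rewrite (@ord2_neq 0 1 j).
rewrite (_ : Ordinal i2 = 1); last exact/val_inj.
by move=> [z0 ->]; split => // j j0; rewrite (@ord2_neq 1 0 j).
Qed.

Lemma setF_bigcup : F = \bigcup_(n in [set n | (0 < n)%N]) segment n.
Proof.
apply/seteqP; split => z.
  case=> -[n /= n0 nz].
    exists (2 * n)%N => /=; first by rewrite muln_gt0.
    by rewrite /segment axis_segment_plane_prod /axis oddM/=.
  exists (2 * n - 1)%N => /=; first lia.
  rewrite /segment axis_segment_plane_prod /axis.
  by have -> : odd (2 * n - 1) by lia.
move=> [n /= n0]; rewrite /segment axis_segment_plane_prod /axis.
have [no|ne] := boolP (odd n) => nz.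
  by right; exists n./2.+1 => //; rewrite (_ : (_ - _)%N = n)//; lia.
by left; exists n./2 => /=; [lia|rewrite (_ : (2 * _)%N = n)//; lia].
Qed.

Lemma segment_subF n : (0 < n)%N -> segment n `<=` F.
Proof. by move=> n0 x nx; rewrite setF_bigcup; exists n. Qed.

Lemma segment_gt0 n x : segment n x -> 0 < x 0 (axis n).
Proof. by move=> [/andP[+ _] _]; apply: lt_le_trans; rewrite divr_gt0// seq_a_gt0. Qed.

Lemma segment_eq0 n x i : segment n x -> axis n != i -> x 0 i = 0.
Proof. by move=> [_ x0] ni; apply: x0; rewrite eq_sym. Qed.

(** Compare the coordinates along [axis m]: that of [x] is at least [a m / 2], while that of [y] is
    either 0 or at most [a n <= a m / 4]. *)
Lemma segment_dist_ge m n x y : (0 < m < n)%N -> segment m x -> segment n y ->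
  a m / 4 <= eucl_dist x y.
Proof.
move=> mn mx ny; have am := @seq_a_gt0 R m.
apply: le_trans (coord_le_eucl_dist x y (axis m)).
have yn : y 0 (axis m) <= a m / 4.
  have [mn'|mn'] := eqVneq (axis n) (axis m).
    by rewrite -mn' (le_trans _ (seq_a_lt_quarter mn))//; case: ny => /andP[].
  by rewrite (segment_eq0 ny)// divr_ge0// ltW.
by rewrite (le_trans _ (ler_norm _))//; case: mx => /andP[+ _] _; lra.
Qed.

Lemma segment_disjoint m n : (0 < m)%N -> (0 < n)%N -> segment m `&` segment n !=set0 ->
  m = n.
Proof.
move=> m0 n0 [x [mx nx]]; have := @seq_a_gt0 R m; have := @seq_a_gt0 R n.
case: (ltngtP m n) => // mn an am.
- exfalso; have := @segment_dist_ge m n x x _ mx nx; rewrite m0 mn eucl_distxx => /(_ isT); lra.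
- exfalso; have := @segment_dist_ge n m x x _ nx mx; rewrite n0 mn eucl_distxx => /(_ isT); lra.
Qed.

Lemma eucl_dist_sqr2 i j x y : j != i ->
  eucl_dist x y ^+ 2 = (x 0 i - y 0 i) ^+ 2 + (x 0 j - y 0 j) ^+ 2.
Proof.
move=> ji; rewrite eucl_dist_sqr (bigD1 i)//=; congr (_ + _).
rewrite (bigD1 j)//= big1 ?addr0// => k /andP[ki]; rewrite (ord2_neq ji ki).
by rewrite eqxx.
Qed.

Lemma collinear_axis j x y w : x 0 j = 0 -> y 0 j = 0 -> w 0 j = 0 -> collinear x y w.
Proof.
move=> xj yj wj; pose i : 'I_2 := if j == 0 then 1 else 0.
have ji : j != i by rewrite /i; case: j {xj yj wj i} => -[|[|]].
pose e : 'rV[R]_2 := delta_mx 0 i.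
have col z : z 0 j = 0 -> z = 0 + z 0 i *: e.
  move=> zj; rewrite add0r. apply/rowP => k; rewrite !mxE eqxx/=.
  have [->|ki] := eqVneq k i; first by rewrite mulr1.
  by rewrite (ord2_neq ji ki) zj mulr0.
exists 0, e => u /= [[->|->]|->].
- by exists (x 0 i); exact: col.
- by exists (y 0 i); exact: col.
- by exists (w 0 i); exact: col.
Qed.

(* The left-hand side is the [j]-coordinate of the circumcenter. *)
Lemma circumradius_ge_axes i j x y w : j != i ->
  x 0 j = 0 -> y 0 j = 0 -> x != y -> w 0 i = 0 -> w 0 j != 0 ->
  (((w 0 j + x 0 i * y 0 i / w 0 j) / 2)%:E <= circumradius x y w)%E.
Proof.
move=> ji xj yj xy wi wj.
have [xyw|/circumradiusP[r -> [c [_ [xc yc wc]]]]] := pselect (collinear x y w).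
  by rewrite /circumradius; case: asboolP => // _; exact: leey.
have {}xy : x 0 i != y 0 i.
  apply: contra_neq xy => xyi; apply/rowP => k.
  have [->//|ki] := eqVneq k i.
  by rewrite (ord2_neq ji ki) xj yj.
have := coord_le_eucl_dist x c j; rewrite xc xj lee_fin.
have := eucl_dist_sqr2 x c ji; have := eucl_dist_sqr2 y c ji.
have := eucl_dist_sqr2 w c ji; rewrite xc yc wc xj yj wi.
move: (c 0 i) (c 0 j) (x 0 i) (y 0 i) (w 0 j) xy wj => p q s t u st u0.
move=> e1 e2 e3 qr; apply: le_trans qr; rewrite sub0r normrN.
(* Equal distances from the center [(p, q)] to [x] and [y] put [p] midway between [s] and [t];
   equality with the distance to [w] then determines [q]. *)
have pE : (s - t) * (2 * p - (s + t)) = 0.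
  by have := etrans (esym e2) e3; lra.
have {}pE : 2 * p = s + t.
  by move/eqP: pE; rewrite mulf_eq0 !subr_eq0 (negbTE st) => /eqP.
suff -> : (u + s * t / u) / 2 = q by exact: ler_norm.
have : 2 * q * u = u ^+ 2 + s * t.
  have := etrans (esym e1) e3; rewrite -[s in RHS](addrK t) -pE; nra.
by move=> qE; rewrite (_ : s * t = 2 * q * u - u ^+ 2); [field|lra].
Qed.

End segments.

(** * Curvature bounds on the segments, and the thickness *)

Section curvature_bounds.
Context {R : realType}.
Implicit Types (m n : nat) (x y z w v : 'rV[R]_2) (i j : 'I_2).
Local Notation a := (@seq_a R).
Local Notation F := (setF R).
Local Notation segment := (@segment R).

(** With [s = x 0 i], [t = v 0 j], [u = w 0 j], the circumcenter has coordinates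
    [(s^2 + t u) / (2 s)] and [(t + u) / 2]. Both lie in [[0, s]], so the squared radius is at most
    [2 s^2]. *)
Lemma circumradius_le_axes i j x v w : j != i ->
  x 0 j = 0 -> v 0 i = 0 -> w 0 i = 0 -> 0 < v 0 j <= x 0 i -> 0 < w 0 j <= x 0 i ->
  v != w -> (circumradius x v w <= (2 * x 0 i)%:E)%E.
Proof.
move=> ji xj vi wi vx wx vw.
have {}vw : v 0 j != w 0 j.
  apply: contra_neq vw => vwj; apply/rowP => k.
  have [->|ki] := eqVneq k i; first by rewrite vi wi.
  by rewrite (ord2_neq ji ki).
(* A line through [v] and [w] has constant [i]-coordinate 0, whereas that of [x] is positive. *)
have ncol : ~ collinear x v w.
  move=> [p [e pe]].
  have [t xt] : exists t : R, x = p + t *: e by apply: pe; left; left.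
  have [s vs] : exists t : R, v = p + t *: e by apply: pe; left; right.
  have [r wr] : exists t : R, w = p + t *: e by apply: pe; right.
  have coord (z : 'rV[R]_2) (l : R) k : z = p + l *: e -> z 0 k = p 0 k + l * e 0 k.
    by move=> ->; rewrite !mxE.
  have sr : s != r.
    by apply: contra_neq vw => sr; rewrite (coord _ _ _ vs) (coord _ _ _ wr) sr.
  have e0 : e 0 i = 0.
    have : (s - r) * e 0 i = 0.
      by rewrite mulrBl; have := coord _ _ i vs; have := coord _ _ i wr; lra.
    by move/eqP; rewrite mulf_eq0 subr_eq0 (negbTE sr) => /eqP.
  have := coord _ _ i xt; have := coord _ _ i vs; rewrite e0 !mulr0 vi.
  by move: vx; lra.
have [r -> [c [_ [xc vc wc]]]] := circumradiusP ncol.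
rewrite lee_fin; have r0 : 0 <= r by rewrite -xc eucl_dist_ge0.
have := eucl_dist_sqr2 x c ji; have := eucl_dist_sqr2 v c ji.
have := eucl_dist_sqr2 w c ji; rewrite xc vc wc xj vi wi.
move: (c 0 i) (c 0 j) (x 0 i) (v 0 j) (w 0 j) vx wx vw => p q s t u.
move=> /andP[t0 ts] /andP[u0 us] tu e1 e2 e3.
have : (t - u) * (2 * q - (t + u)) = 0 by have := etrans (esym e1) e2; lra.
move/eqP; rewrite mulf_eq0 !subr_eq0 (negbTE tu) => /eqP qE.
have pE : 2 * s * p = s ^+ 2 + t * u.
  by have := etrans (esym e3) e2; rewrite -[in X in _ = X -> _](addrK u t) -qE; nra.
have p0 : 0 <= p by nra.
have ps : p <= s by nra.
rewrite -(@ler_pXn2r _ 2)// ?nnegrE ?mulr_ge0// ?e3; nra.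
Qed.

(** The witnesses are the two ends of the next segment. They lie on the other axis at height at most
    [a n / 4], below the coordinate of [x], which is at least [a n / 2]. *)
Lemma circumradius_le_next n x : (0 < n)%N -> segment n x -> exists v w,
  [/\ F v, F w, distinct3 x v w & (circumradius x v w <= (2 * a n)%:E)%E].
Proof.
move=> n0 nx; pose j := axis n.+1; have ji : j != axis n := axis_succ n.
have an := @seq_a_gt0 R n; have an1 := @seq_a_gt0 R n.+1.
have aS : a n.+1 <= a n / 4 by exact: seq_aS_le_quarter.
pose pt (t : R) : 'rV[R]_2 := \row_k (if k == j then t else 0).
have ptj t : pt t 0 j = t by rewrite mxE eqxx.
have pti t : pt t 0 (axis n) = 0 by rewrite mxE eq_sym (negbTE ji).
have Sv t : a n.+1 / 2 <= t <= a n.+1 -> segment n.+1 (pt t).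
  move=> tA; split; first by rewrite ptj.
  by move=> k kj; rewrite mxE (negbTE kj).
have /andP[xl xu] : a n / 2 <= x 0 (axis n) <= a n by case: nx.
have vw : pt (a n.+1) != pt (a n.+1 / 2).
  by apply/eqP => /rowP/(_ j); rewrite !ptj; lra.
exists (pt (a n.+1)), (pt (a n.+1 / 2)); split.
- by apply: (@segment_subF _ n.+1) => //; apply: Sv; lra.
- by apply: (@segment_subF _ n.+1) => //; apply: Sv; lra.
- have xpt t : x != pt t.
    by apply/eqP => /rowP/(_ (axis n)); rewrite pti; lra.
  by rewrite /distinct3 vw !xpt.
- apply: le_trans (circumradius_le_axes ji _ _ _ _ _ vw) _; rewrite ?ptj//.
  + by rewrite (segment_eq0 nx)// eq_sym.
  + by lra.
  + by lra.
  + by rewrite lee_fin; lra.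
Qed.

(* Points in different segments are far apart; for two points of the same segment,
   [w] matters only on the other axis, at height [c] either at least [a (n-1) / 2] or at
   most [a n ^ 2], and the circumcenter lies at height at least [(c + a n ^ 2 / (4c)) / 2]. *)
Lemma circumradius_ge_F m n x y w : (0 < m)%N -> (0 < n)%N ->
  segment m x -> segment n y -> x != y -> F w ->
  ((a (maxn m n).-1 / 8)%:E <= circumradius x y w)%E.
Proof.
move=> m0 n0 mx ny xy Fw.
(* Weakening [a k] to [a l.-1] leaves a bound in terms of the larger index only. *)
have dist k l u v : (0 < k < l)%N -> segment k u -> segment l v ->
    a l.-1 / 8 <= eucl_dist u v / 2.
  move=> /[dup] /andP[k0 kl] kl' ku lv; have := segment_dist_ge kl' ku lv.
  have : a l.-1 <= a k by apply: seq_a_nincr; rewrite -ltnS (ltn_predK kl).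
  by lra.
case: (ltngtP m n) => mn.
- apply: le_trans (eucl_dist_le_circumradius x y w).
  by rewrite lee_fin; apply: dist mx ny; rewrite m0.
- apply: le_trans (eucl_dist_le_circumradius x y w).
  by rewrite lee_fin eucl_distC; apply: dist ny mx; rewrite n0.
- move: mx; rewrite mn {m m0 mn dist} => nx.
  move: Fw; rewrite setF_bigcup => -[k /= k0 kw].
  have [kn|kn] := eqVneq (axis k) (axis n).
    have [j jn] : exists j, axis n != j by exists (axis n.+1); rewrite eq_sym axis_succ.
    rewrite /circumradius; case: asboolP => [_|]; first exact: leey.
    case; apply: (@collinear_axis _ j).
    - exact: segment_eq0 nx jn.
    - exact: segment_eq0 ny jn.
    - by apply: segment_eq0 kw _; rewrite kn.
  apply: le_trans (circumradius_ge_axes kn _ _ xy _ _).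
  + rewrite lee_fin.
    have w0 := segment_gt0 kw.
    have /andP[wl wu] : a k / 2 <= w 0 (axis k) <= a k by case: kw.
    have /andP[xl xu] : a n / 2 <= x 0 (axis n) <= a n by case: nx.
    have /andP[yl yu] : a n / 2 <= y 0 (axis n) <= a n by case: ny.
    have an := @seq_a_gt0 R n.
    have xyn : a n ^+ 2 / 4 <= x 0 (axis n) * y 0 (axis n) by nra.
    have xy0 : 0 <= x 0 (axis n) * y 0 (axis n) / w 0 (axis k).
      by rewrite divr_ge0 ?(ltW w0)//; nra.
    have := @seq_a_gt0 R n.-1; have := @seq_a_le1 R n.-1.
    case: (ltngtP k n) => [kln|nlk|kE]; last by rewrite kE eqxx in kn.
      have : a n.-1 <= a k by apply: seq_a_nincr; rewrite -ltnS prednK.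
      by lra.
    (* A quotient of at least 1/4 gives radius at least 1/8, which is enough because
       [a n.-1 <= 1]. *)
    suff : 4^-1 <= x 0 (axis n) * y 0 (axis n) / w 0 (axis k) by lra.
    rewrite ler_pdivlMr//.
    have : a k <= a n ^+ 2 by exact: le_trans (seq_a_nincr nlk) (seq_aS_le_sqr n0).
    by lra.
  + by rewrite (segment_eq0 nx)// eq_sym.
  + by rewrite (segment_eq0 ny)// eq_sym.
  + by rewrite (segment_eq0 kw).
  + by rewrite gt_eqF// (segment_gt0 kw).
Qed.

Lemma lee_poweR (p : R) (u v : \bar R) : 0 <= p -> (0 <= u)%E -> (u <= v)%E ->
  (u `^ p <= v `^ p)%E.
Proof.
move=> p0 u0 uv; apply: gt0_ler_poweR => //; rewrite in_itv/= leey andbT//.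
exact: le_trans u0 uv.
Qed.

(** The reciprocal of the radius bound [a n.-1 / 8]; since [a 0 = 1], it equals 8 on the first
    segment. *)
Definition weight n : R := 8 / a n.-1.

Lemma weight_ge1 n : 1 <= weight n.
Proof.
rewrite ler_pdivlMr ?seq_a_gt0// mul1r; have := @seq_a_le1 R n.-1; lra.
Qed.

Lemma kappa_i_le m n x y : (0 < m)%N -> (0 < n)%N -> segment m x -> segment n y ->
  (kappa_i F x y <= (weight (maxn m n))%:E)%E.
Proof.
move=> m0 n0 mx ny; rewrite /kappa_i; case: eqVneq => [_|xy].
  by rewrite lee_fin (le_trans _ (weight_ge1 _)).
have a8 : 0 < a (maxn m n).-1 / 8 by rewrite divr_gt0// seq_a_gt0.
rewrite div1e -[weight _]invf_div -[X in (_ <= X%:E)%E]/(_^-1).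
have -> : ((a (maxn m n).-1 / 8)^-1%:E = (a (maxn m n).-1 / 8)%:E^-1)%E.
  by rewrite inver gt_eqF.
rewrite lee_pV2 ?inE/=.
- by apply: le_ereal_inf_tmp => _ [w [Fw _] <-]; exact: circumradius_ge_F Fw.
- by apply: le_ereal_inf_tmp => _ [w _ <-]; exact: circumradius_ge0.
- by rewrite lee_fin ltW.
Qed.

(** All weights are at least 1, so [p] may be raised to the integer [P] and the weight at the larger
    index replaced by a product. This separates the variables. *)
Lemma kappa_i_poweR_le (p : R) (P m n : nat) x y : 0 < p <= P%:R ->
  (0 < m)%N -> (0 < n)%N -> segment m x -> segment n y ->
  (kappa_i F x y `^ p <= (weight m ^+ P * weight n ^+ P)%:E)%E.
Proof.
move=> /andP[p0 pP] m0 n0 mx ny; set M := maxn m n.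
have k0 : (0 <= kappa_i F x y)%E.
  rewrite /kappa_i; case: eqP => // _; rewrite div1e inve_ge0.
  by apply: le_ereal_inf_tmp => _ [w _ <-]; exact: circumradius_ge0.
have wM := weight_ge1 M.
apply: (@le_trans _ _ ((weight M)%:E `^ p)%E).
  by apply: lee_poweR; [exact: ltW|exact: k0|exact: kappa_i_le].
rewrite poweR_EFin lee_fin (@le_trans _ _ (weight M ^+ P))//.
  by rewrite -powR_mulrn ?ler_powR// (le_trans _ wM).
have wP k : 1 <= weight k ^+ P by rewrite exprn_ege1// weight_ge1.
have wP0 k : 0 <= weight k ^+ P by rewrite (le_trans _ (wP k)).
by rewrite /M; case: (leqP m n) => _; [rewrite ler_peMl|rewrite ler_peMr].
Qed.

Lemma kappa_poweR_le_kappa_i (p : R) x y z : 0 < p -> F z ->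
  (kappa x y z `^ p <= kappa_i F x y `^ p)%E.
Proof.
move=> p0 Fz.
have inf0 : (0 <= ereal_inf [set circumradius x y w | w in F `\` [set x; y]])%E.
  by apply: le_ereal_inf_tmp => _ [w _ <-]; exact: circumradius_ge0.
have ki0 : (0 <= kappa_i F x y)%E.
  by rewrite /kappa_i; case: eqP => // _; rewrite div1e inve_ge0.
have k0 : (0 <= kappa x y z)%E.
  by rewrite /kappa; case: ifP => // _; rewrite div1e inve_ge0 circumradius_ge0.
apply: lee_poweR; [exact: ltW|exact: k0|].
move: ki0; rewrite /kappa; case: ifP => // /and3P[xy yz xz] _.
rewrite /kappa_i (negbTE xy) !div1e lee_pV2 ?inE ?circumradius_ge0//.
apply: ereal_inf_lbound; exists z => //; split => //= -[zx|zy].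
  by rewrite zx eqxx in xz.
by rewrite zy eqxx in yz.
Qed.

Lemma kappa_G_ge n x : (0 < n)%N -> segment n x ->
  ((2 * a n)^-1%:E <= kappa_G F x)%E.
Proof.
move=> n0 nx; have an := @seq_a_gt0 R n.
have [v [w [Fv Fw xvw rle]]] := circumradius_le_next n0 nx.
have -> : ((2 * a n)^-1%:E = (2 * a n)%:E^-1)%E.
  by rewrite inver gt_eqF// mulr_gt0.
rewrite /kappa_G div1e lee_pV2 ?inE/=.
- by apply: le_trans rle; apply: ereal_inf_lbound; exists v, w.
- by rewrite lee_fin mulr_ge0// ltW.
- by apply: le_ereal_inf_tmp => _ [? [? [_ ->]]]; exact: circumradius_ge0.
Qed.

(** Since [1 / a n >= 1] and [p >= 1], its [p]-th power is at least [1 / a n], which is what the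
    length [a n / 2] of the segment cancels. *)
Lemma kappa_G_poweR_ge (p : R) n x : 1 <= p -> (0 < n)%N -> segment n x ->
  ((2^-1 `^ p / a n)%:E <= kappa_G F x `^ p)%E.
Proof.
move=> p1 n0 nx; have an := @seq_a_gt0 R n.
have p0 : 0 <= p by rewrite (le_trans _ p1).
apply: (@le_trans _ _ ((2 * a n)^-1%:E `^ p)%E).
  rewrite poweR_EFin lee_fin invfM powRM ?invr_ge0//.
  by rewrite ler_wpM2l ?powR_ge0// le1r_powR// invf_ge1 ?seq_a_le1.
apply: lee_poweR => //; last exact: kappa_G_ge.
by rewrite lee_fin invr_ge0 mulr_ge0// ltW.
Qed.

Lemma thickness_setF : thickness F = 0%E.
Proof.
apply/eqP; rewrite eq_le; apply/andP; split; last first.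
  by apply: le_ereal_inf_tmp => _ [? [? [? [_ ->]]]]; exact: circumradius_ge0.
apply/lee_addgt0Pr => e e0; rewrite add0e.
(* Half of [e] absorbs the factor 2 in the radius bound; the index [N.+1] is positive. *)
have [N Ne] := @seq_a_lt R (e / 2) (divr_gt0 e0 (ltr0n _ 2)).
have {}Ne := Ne N.+1 (leqnSn N).
pose x : 'rV[R]_2 := \row_k (if k == axis N.+1 then a N.+1 else 0).
have Nx : segment N.+1 x.
  have aN := @seq_a_gt0 R N.+1; split=> [|j ji]; last by rewrite mxE (negbTE ji).
  by rewrite mxE eqxx; lra.
have [v [w [Fv Fw xvw rle]]] := circumradius_le_next (ltn0Sn N) Nx.
apply: le_trans (_ : (2 * a N.+1)%:E <= _)%E; last by rewrite lee_fin; lra.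
apply: le_trans rle; apply: ereal_inf_lbound; exists x, v, w; split => //; split => //.
exact: segment_subF Nx.
Qed.

End curvature_bounds.

(** * Monotonicity of integrals of nonnegative functions *)

Section integral.
Local Open Scope ereal_scope.
Context d (T : measurableType d) (R : realType).
Variables (mu : {measure set T -> \bar R}) (D : set T).
Implicit Types f g : T -> \bar R.
Import HBNNSimple.

(* The integral of a nonnegative function is a supremum over simple functions,
   hence monotone without any measurability assumption. *)
Lemma ge0_le_integral_nonmeasurable f g : (forall x, D x -> 0 <= f x) ->
  (forall x, D x -> f x <= g x) -> \int[mu]_(x in D) f x <= \int[mu]_(x in D) g x.
Proof.
move=> f0 fg; have g0 x : D x -> 0 <= g x by move=> Dx; apply: le_trans (fg _ Dx); exact: f0.
rewrite !ge0_integralE//; apply: ereal_sup_le => _ [h /= hf <-]; exists h => //= x.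
by apply: le_trans (hf x) _; rewrite /patch; case: ifPn => //; rewrite inE => /fg.
Qed.

End integral.

(** * Functions constant on each segment, and their integrals *)

Section step.
Local Open Scope ereal_scope.
Context {R : realType}.
Implicit Types (m n : nat) (c : nat -> R).
Local Notation F := (setF R : set (H1space R 2)).
Local Notation segment := (@segment R).
Local Notation a := (@seq_a R).

(** The shift pairs [c n] with [segment n.+1], so that a series over all of [nat] runs exactly
    through the segments of [F]. *)
Definition step c (x : H1space R 2) : \bar R :=
  \sum_(n <oo) (c n)%:E * (\1_(segment n.+1 : set (H1space R 2)) x)%:E.

Lemma measurable_segment n : @measurable _ (H1space R 2) (segment n).
Proof. exact: H1_measurable_axis_segment. Qed.

Lemma measurable_setF : @measurable _ (H1space R 2) F.
Proof.
by rewrite setF_bigcup; apply: bigcup_measurable => n _; exact: measurable_segment.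
Qed.

Let term_ge0 c n (x : H1space R 2) : (forall n, 0 <= c n)%R ->
  0 <= (c n)%:E * (\1_(segment n.+1 : set (H1space R 2)) x)%:E.
Proof. by move=> c0; rewrite mule_ge0// lee_fin. Qed.

Lemma step_ge0 c x : (forall n, 0 <= c n)%R -> 0 <= step c x.
Proof. by move=> c0; apply: nneseries_ge0 => n _ _; exact: term_ge0. Qed.

Let measurable_term c n : measurable_fun F
  (fun x : H1space R 2 => (c n)%:E * (\1_(segment n.+1 : set (H1space R 2)) x)%:E).
Proof.
apply: measurable_funeM; apply/measurable_EFinP.
by apply: measurable_indic; exact: measurable_segment.
Qed.

Lemma measurable_step c : (forall n, 0 <= c n)%R -> measurable_fun F (step c).
Proof.
by move=> c0; apply: ge0_emeasurable_sum => n *; [exact: term_ge0|exact: measurable_term].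
Qed.

Lemma integral_step c : (forall n, 0 <= c n)%R ->
  \int[H1]_(x in F) step c x =
  \sum_(n <oo) (c n)%:E * hausdorff1 (segment n.+1).
Proof.
move=> c0; rewrite integral_nneseries//; [|exact: measurable_setF|by move=> *; exact: term_ge0].
apply: eq_eseriesr => n _; rewrite ge0_integralZl_EFin; last exact: c0.
- congr (_ * _); rewrite integral_indic; [|exact: measurable_setF|exact: measurable_segment].
  by rewrite (setIidl (@segment_subF R n.+1 _)).
- exact: measurable_setF.
- by move=> x _; rewrite lee_fin.
- by apply/measurable_EFinP; apply: measurable_indic; exact: measurable_segment.
Qed.

Lemma le_step c n x : (forall n, 0 <= c n)%R -> segment n.+1 x -> (c n)%:E <= step c x.
Proof.
move=> c0 nx; rewrite /step (@nneseriesD1 _ _ n)//; last by move=> k _; exact: term_ge0.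
rewrite indicE mem_set// mule1 leeDl//.
by apply: nneseries_ge0 => k _ _; exact: term_ge0.
Qed.

Lemma stepE c n x : (forall n, 0 <= c n)%R -> segment n.+1 x -> step c x = (c n)%:E.
Proof.
move=> c0 nx; rewrite /step (@nneseriesD1 _ _ n)//; last by move=> k _; exact: term_ge0.
rewrite indicE mem_set// mule1 eseries0 ?adde0// => k _ /= kn.
rewrite indicE memNset ?mule0// => kx.
have /eqP := @segment_disjoint R k.+1 n.+1 isT isT (ex_intro _ x (conj kx nx)).
by rewrite eqSS (negbTE kn).
Qed.

End step.

(** * Finiteness and divergence of the energies *)

Section energies.
Context {R : realType}.
Implicit Types (m n P : nat) (p : R).
Local Notation F := (setF R : set (H1space R 2)).
Local Notation segment := (@segment R).
Local Notation a := (@seq_a R).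
Local Notation weight := (@weight R).
Local Notation step_weight P := (@step R (fun n => weight n.+1 ^+ P)).

Lemma hausdorff1_segment n : hausdorff1 (segment n) = (a n / 2)%:E.
Proof.
have an := @seq_a_gt0 R n; rewrite (_ : a n / 2 = a n - a n / 2); last lra.
apply/eqP; rewrite eq_le le_hausdorff1_axis_segment hausdorff1_axis_segment_le//; lra.
Qed.

Lemma weight_expr_ge0 P n : 0 <= weight n ^+ P.
Proof. by rewrite exprn_ge0// (le_trans _ (weight_ge1 _)). Qed.

(** The constant absorbs the indices [n <= P]; beyond them the next exponent is at least [P + 2]
    times the current one, which itself is at least [n]. *)
Lemma exponent_growth P : exists C, forall n,
  (P * (n ^ n * n ^ 3) + n.+1 <= n.+1 ^ n.+1 * n.+1 ^ 3 + C)%N.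
Proof.
exists (P * (P ^ P * P ^ 3) + P.+1)%N => n.
have [nP|Pn] := leqP n P.
  have /(leq_mul (leqnn P)) := exponent_homo nP; lia.
have := exponent_succ n; have := le_exponent n.
move: (n ^ n * n ^ 3)%N (n.+1 ^ n.+1 * n.+1 ^ 3)%N => e e' ne ee'.
have : (P.+2 * e <= n.+1 * e)%N by rewrite leq_mul.
lia.
Qed.

(** Up to the factor [8 ^ P], the left side is at most 2 to the power [P] times the exponent at [n]
    minus the exponent at [n+1]. The geometric form of the bound makes the series summable. *)
Lemma weight_seq_a_le P : exists2 K : R, 0 <= K &
  forall n, weight n.+1 ^+ P * (a n.+1 / 2) <= K / (2 ^ n.+1)%:R.
Proof.
have [C HC] := exponent_growth P.
exists (8 ^+ P * 2 ^+ C) => [|n]; first by rewrite mulr_ge0// exprn_ge0.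
apply: (@le_trans _ _ (weight n.+1 ^+ P * a n.+1)).
  by rewrite ler_wpM2l ?weight_expr_ge0//; have := @seq_a_gt0 R n.+1; lra.
have aE : (a n)^-1 = 2 ^+ (n ^ n * n ^ 3) by rewrite /seq_a invrK.
rewrite /weight /= exprMn aE -!mulrA ler_wpM2l ?exprn_ge0// /seq_a -exprM.
rewrite natrX ler_pdivrMr ?exprn_gt0// mulrAC ler_pdivlMr ?exprn_gt0// -!exprD.
by rewrite ler_weXn2l ?ler1n// mulnC addnC (addnC C); move: (HC n); rewrite addnC.
Qed.

Lemma integral_step_weight_lty P :
  (\int[H1]_(x in F) step_weight P x < +oo)%E.
Proof.
rewrite integral_step => [|n]; last exact: weight_expr_ge0.
have [K K0 HK] := weight_seq_a_le P.
apply: (@le_lt_trans _ _ K%:E); last exact: ltry.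
apply: le_trans (epsilon_trick0 xpredT K0); apply: lee_nneseries => n _.
  by rewrite mule_ge0 ?hausdorff1_ge0// lee_fin weight_expr_ge0.
by rewrite hausdorff1_segment -EFinM lee_fin.
Qed.

Lemma setF_ind (A : 'rV[R]_2 -> Prop) :
  (forall n x, segment n.+1 x -> A x) -> forall x, F x -> A x.
Proof. by move=> SA x; rewrite setF_bigcup => -[[//|n] _]; exact: SA. Qed.

Lemma kappa_i_poweR_le_step p P x y : 0 < p <= P%:R -> F x -> F y ->
  (kappa_i F x y `^ p <= step_weight P x * step_weight P y)%E.
Proof.
move=> pP; elim/setF_ind => [m {}x mx]; elim/setF_ind => [n {}y ny].
apply: le_trans (kappa_i_poweR_le pP _ _ mx ny) _ => //.
have w0 k : 0 <= weight k.+1 ^+ P by exact: weight_expr_ge0.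
by rewrite EFinM lee_pmul ?lee_fin// (le_step w0).
Qed.

(** After the pointwise bound by a product, the factor in [y] is pulled out of the inner integral,
    then the remaining integral out of the outer one. *)
Lemma iterated_integral_kappa_i_le p P : 0 < p <= P%:R ->
  (\int[H1]_(y in F) \int[H1]_(x in F) (kappa_i F x y `^ p) <=
   \int[H1]_(x in F) step_weight P x * \int[H1]_(x in F) step_weight P x)%E.
Proof.
move=> pP; set I := (X in (_ <= X * _)%E); have w0 k : 0 <= weight k.+1 ^+ P by exact: weight_expr_ge0.
have I0 : (0 <= I)%E by apply: integral_ge0 => x _; exact: step_ge0.
rewrite -[leRHS](ge0_integralZl _ measurable_setF (measurable_step w0) _ I0); last first.
  by move=> x _; exact: step_ge0.
apply: ge0_le_integral_nonmeasurable => [y Fy|y Fy].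
  by apply: integral_ge0 => x _; exact: poweR_ge0.
rewrite muleC -(ge0_integralZl _ measurable_setF (measurable_step w0)); last 2 first.
- by move=> x _; exact: step_ge0.
- exact: step_ge0.
apply: ge0_le_integral_nonmeasurable => [x Fx|x Fx]; first exact: poweR_ge0.
by rewrite muleC kappa_i_poweR_le_step.
Qed.

Lemma energyI_lty p : 0 < p -> (energyI p F < +oo)%E.
Proof.
move=> p0; pose P := (Num.truncn p).+1.
have pP : 0 < p <= P%:R by rewrite p0 ltW// truncnS_gt.
apply: le_lt_trans (iterated_integral_kappa_i_le pP) _.
have I0 : (0 <= \int[H1]_(x in F) step_weight P x)%E.
  by apply: integral_ge0 => x _; apply: step_ge0 => n; exact: weight_expr_ge0.
by rewrite lte_mul_pinfty// ?ge0_fin_numE// integral_step_weight_lty.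
Qed.

Lemma energyM_lty p : 0 < p -> (energyM p F < +oo)%E.
Proof.
move=> p0; pose P := (Num.truncn p).+1.
have pP : 0 < p <= P%:R by rewrite p0 ltW// truncnS_gt.
have w0 k : 0 <= weight k.+1 ^+ P by exact: weight_expr_ge0.
pose I := (\int[H1]_(x in F) step_weight P x)%E.
have I0 : (0 <= I)%E by apply: integral_ge0 => x _; exact: step_ge0.
have Ioo : (I < +oo)%E := integral_step_weight_lty P.
have IIoo : (I * I < +oo)%E by rewrite lte_mul_pinfty// ge0_fin_numE.
apply: (@le_lt_trans _ _ (I * I * I)%E); last first.
  by rewrite lte_mul_pinfty ?mule_ge0// ge0_fin_numE ?mule_ge0.
rewrite -(ge0_integralZl _ measurable_setF (measurable_step w0)); last 2 first.
- by move=> x _; exact: step_ge0.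
- exact: mule_ge0.
apply: ge0_le_integral_nonmeasurable => [z Fz|z Fz].
  by apply: integral_ge0 => y _; apply: integral_ge0 => x _; exact: poweR_ge0.
(* For fixed [z] the double integral is at most [I * I]; the extra factor [step_weight P z] is at
   least 1 on [F]. *)
apply: le_trans (_ : I * I <= _)%E.
  apply: le_trans (iterated_integral_kappa_i_le pP).
  apply: ge0_le_integral_nonmeasurable => [y Fy|y Fy].
    by apply: integral_ge0 => x _; exact: poweR_ge0.
  apply: ge0_le_integral_nonmeasurable => [x Fx|x Fx]; first exact: poweR_ge0.
  exact: kappa_poweR_le_kappa_i.
rewrite lee_pemulr ?mule_ge0//.
move: z Fz; apply: setF_ind => n z nz; apply: le_trans (le_step w0 nz).
by rewrite lee_fin exprn_ege1// weight_ge1.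
Qed.

(** The integrand dominates a step function with value [q / a n] on the [n]-th segment, of length
    [a n / 2]: every segment contributes at least [q / 2]. *)
Lemma energyU_pinfty p : 1 <= p -> energyU p F = +oo%E.
Proof.
move=> p1; pose q : R := 2^-1 `^ p; have q0 : 0 < q by rewrite powR_gt0// invr_gt0.
pose c n := q / a n.+1.
have c0 n : 0 <= c n by rewrite divr_ge0 ?ltW// seq_a_gt0.
apply/eqP; rewrite -leye_eq.
apply: (@le_trans _ _ (\int[H1]_(x in F) step c x)%E); last first.
  apply: ge0_le_integral_nonmeasurable => [x _|]; first exact: step_ge0.
  by apply: setF_ind => n x nx; rewrite (stepE c0 nx) kappa_G_poweR_ge.
rewrite integral_step//.
have -> : (\sum_(n <oo) (c n)%:E * hausdorff1 (segment n.+1) = \sum_(n <oo) (q / 2)%:E)%E.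
  apply: eq_eseriesr => n _; rewrite hausdorff1_segment -EFinM; congr EFin.
  by rewrite /c; field; rewrite gt_eqF// seq_a_gt0.
have q20 : 0 < q / 2 by rewrite divr_gt0.
(* [N] terms equal to [q / 2] already exceed [A]. *)
rewrite leye_eq; apply/eqP/eqyP => A A0; pose N := (Num.truncn (A / (q / 2))).+1.
apply: le_trans (@nneseries_lim_ge _ (fun=> (q / 2)%:E) xpredT 0 N _); last first.
  by move=> *; rewrite lee_fin ltW.
rewrite sumEFin big_const_nat subn0 iter_addr_0 lee_fin -[leRHS]mulr_natr mulrC.
by rewrite -ler_pdivrMr// ltW// truncnS_gt.
Qed.

End energies.

(** * Absence of an approximate tangent at the origin *)

Section tangent.
Context {R : realType}.
Implicit Types (n : nat) (s v y : 'rV[R]_2) (i : 'I_2).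
Local Notation a := (@seq_a R).
Local Notation F := (setF R).
Local Notation segment := (@segment R).

Lemma eucl_dot_axis i y v : (forall j, j != i -> y 0 j = 0) ->
  eucl_dot y v = y 0 i * v 0 i.
Proof.
move=> y0; rewrite /eucl_dot (bigD1 i)//= big1 ?addr0// => j ji.
by rewrite y0// mul0r.
Qed.

Lemma angle_axis i y v : (forall j, j != i -> y 0 j = 0) -> 0 < y 0 i ->
  eucl_norm v = 1 -> angle y 0 v = acos (v 0 i).
Proof.
move=> y0 yi v1; rewrite /angle !subr0 v1 mulr1; congr acos.
rewrite (_ : eucl_norm y = y 0 i); last first.
  by rewrite /eucl_norm (eucl_dot_axis _ y0) -expr2 sqrtr_sqr gtr0_norm.
by rewrite (eucl_dot_axis _ y0) mulrAC divff ?mul1r// gt_eqF.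
Qed.

Lemma eucl_normN v : eucl_norm (- v) = eucl_norm v.
Proof. by rewrite /eucl_norm eucl_dotNl eucl_dotNr opprK. Qed.

(** The squares of the two coordinates sum to 1, so one is at most 1/2: some axis is not parallel to
    [s]. The boolean, read as 0 or 1, is also the parity of the segments on that axis. *)
Lemma unit_coord_lt1 s : eucl_norm s = 1 -> exists b : bool, -1 < s 0 (axis b) < 1.
Proof.
move=> s1; have : eucl_norm s ^+ 2 = 1 by rewrite s1 expr1n.
rewrite -[s]subr0 -/(eucl_dist s 0) (@eucl_dist_sqr2 _ 0 1)// !mxE !subr0 => s01.
have [h|h] := leP (s 0 0 ^+ 2) (1 / 2).
  by exists false; apply/andP; split; rewrite /axis /=; nra.
by exists true; apply/andP; split; rewrite /axis /=; nra.
Qed.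

Lemma setF_no_approx_tangent : ~ has_approx_tangent F 0.
Proof.
move=> [s [s1 H]]; have [b /andP[si1 si2]] := unit_coord_lt1 s1.
(* [eps] is the smaller of the angles between the positive [i]-axis and [s], [- s]; the cone
   inequality being strict, points of that half-axis stay outside the cone. *)
pose i := axis b; pose eps : R := Num.min (acos (- s 0 i)) (acos (s 0 i)).
have eps0 : 0 < eps.
  by rewrite lt_min !acos_gt0//; apply/andP; split; rewrite -/i in si1 si2 *; lra.
have segC n : segment n `<=` F `\` double_cone s eps 0 ->
    ((a n / 2)%:E <= hausdorff1 ((F `\` double_cone s eps 0) `&` eucl_closed_ball 0 (a n)))%E.
  move=> nC; rewrite -hausdorff1_segment; apply: le_hausdorff1 => y ny.
  split; first exact: nC.
  rewrite /eucl_closed_ball /= (@eucl_dist_axis _ _ (axis n)); last first.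
    by move=> j jn; rewrite mxE (segment_eq0 ny)// eq_sym.
  rewrite mxE subr0 gtr0_norm ?(segment_gt0 ny)//.
  by case: ny => /andP[].
have segcone n : (0 < n)%N -> axis n = i -> segment n `<=` F `\` double_cone s eps 0.
  move=> n0 ni y ny; split; first exact: segment_subF ny.
  move=> -[_]; have [_ yj] := ny; have yi := segment_gt0 ny; rewrite ni in yj yi.
  rewrite sub0r add0r !(angle_axis yj yi) ?eucl_normN//.
  by rewrite mxE ltxx.
(* The threshold 1/8 lies below the density [(a n / 2) / (2 * a n) = 1 / 4] found at the radii
   [a n]. *)
have := H _ eps0; move=> /(_ [set u | u < (1 / 8)%:E]%E)[].
  by apply: open_ereal_lt'; rewrite lte_fin divr_gt0.
move=> d /= d0 dP; have [N HN] := @seq_a_lt R d d0.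
(* A positive index beyond [N] with the parity of [b], so that its segment lies on the chosen
   axis. *)
pose n := (N.*2.+2 + b)%N.
have ni : axis n = i by rewrite /n /i /axis oddD /= odd_double; case: (b).
have n0 : (0 < n)%N by rewrite /n.
have an := @seq_a_gt0 R n.
have nd : a n < d by apply: HN; rewrite /n -addnn; lia.
have := dP (a n); rewrite /= sub0r normrN gtr0_norm// => /(_ nd an).
apply/negP; rewrite -leNgt.
have := segC _ (segcone _ n0 ni); set h := hausdorff1 _ => hn.
apply: (@le_trans _ _ ((a n / 2)%:E / (2 * a n)%:E)%E); last first.
  by rewrite lee_pmul2r// inver gt_eqF ?mulr_gt0// lte_fin invr_gt0 mulr_gt0.
rewrite inver gt_eqF ?mulr_gt0// -EFinM lee_fin.
rewrite (_ : a n / 2 / (2 * a n) = 1 / 4); first lra.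
by field; rewrite gt_eqF.
Qed.

End tangent.

Theorem lemma8p2 (R : realType) :
  [/\ ~ has_approx_tangent (setF R) 0,
      (1 / thickness (setF R) = +oo)%E,
      (forall p : R, 1 <= p -> energyU p (setF R) = +oo%E),
      (forall p : R, 0 < p -> (energyI p (setF R) < +oo)%E) &
      (forall p : R, 0 < p -> (energyM p (setF R) < +oo)%E)].
Proof.
split.
- exact: setF_no_approx_tangent.
- by rewrite thickness_setF div1e inve0.
- exact: energyU_pinfty.
- exact: energyI_lty.
- exact: energyM_lty.
Qed.
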